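(* Let $\mathcal{P}$ be the group of affine maps $z\mapsto az+b$ ($a,b\in\mathbb{R}$, $a>0$). A $\mathcal{P}$-solenoid does not admit a (nonzero) foliated cycle.
   Context: **Affine group.** $\mathcal{P}$ is the Lie group of isometries $z\mapsto az+b$ ($a,b\in\mathbb{R}$, $a>0$) of $\mathbb{H}^2=\{x+iy:y>0\}$, identified with $\mathbb{H}^2$ via $(z\mapsto yz+x)\leftrightarrow(x,y)$. Left multiplication is the isometric (orientation-preserving) action, and right multiplication by $g:z\mapsto az+b$ is $(x,y).g=(x+by,ay)$. **$\mathcal{P}$-solenoid.** A compact (nonempty) metric space $M$ with an atlas, i.e. a cover by open sets $U_i$ and homeomorphisms (charts) $h_i:U_i\to V_i\times C_i$, with $V_i$ open in $\mathcal{P}$ and $C_i$ a totally disconnected compact metric space, whose transition maps have the form $h_i\circ h_j^{-1}(x,c)=(f_{i,j}\cdot x,\,g_{i,j}(c))$, where $f_{i,j}\in\mathcal{P}$ acts by left multiplication and is independent of $x,c$, and $g_{i,j}$ is continuous and independent of $x$; atlases are considered up to equivalence (the union is an atlas). Slices are the sets $h_i^{-1}(V_i\times\{c\})$; leaves are obtained by gluing slices that intersect, and are oriented 2-manifolds. It is part of the definition that each leaf is diffeomorphic to $\mathbb{H}^2$ and that the local right multiplication extends to a free continuous right action of $\mathcal{P}$ on $M$ whose orbits are the leaves; in charts it reads $(z,c).g=(zg,c)$ whenever $z,zg\in V_i$. **Differential forms.** A $k$-differential form on $M$ is given in each box by a family of $C^\infty$ real $k$-forms on the slices $V_i\times\{c\}$,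 depending continuously on $c$ in the $C^\infty$ topology, these families being mapped to each other by the transition maps. $A^k(M)$ is the space of such forms, and $d:A^k(M)\to A^{k+1}(M)$ is differentiation along leaves. **Foliated cycle.** A continuous linear form $A^2(M)\to\mathbb{R}$ that is positive on positive forms and vanishes on exact forms (elements of $dA^1(M)$). The trivial zero form is not regarded as a foliated cycle. *)

(* Defs.v *)
From HB Require Import structures.
From mathcomp Require Import all_boot all_order all_algebra.
From mathcomp Require Import all_classical all_reals all_analysis.
From mathcomp Require Import ring.

Set Implicit Arguments.
Unset Strict Implicit.
Unset Printing Implicit Defensive.

Import Order.TTheory GRing.Theory Num.Theory.
Import numFieldNormedType.Exports.

Local Open Scope classical_set_scope.
Local Open Scope ring_scope.

Section AffineGroup.
Context {R : realType}.

(* The pair (x, y) with 0 < y stands for the map z |-> y z + x, so that the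
   affine group is the open upper half-plane of R * R. *)
Definition affP : set (R * R) := [set g | 0 < g.2].

Definition affM (g h : R * R) : R * R := (g.1 + h.1 * g.2, h.2 * g.2).

Definition aff1 : R * R := (0, 1).

End AffineGroup.

Section Smooth.
Context {R : realType}.
Implicit Types (V : set (R * R)) (f : R * R -> R).

Definition iter_derive (s : seq (R * R)) f : R * R -> R :=
  foldr (fun v g => 'D_v g) f s.

(* C^infty on an open set V: all iterated directional derivatives exist and
   are continuous. *)
Definition smooth_on V f := forall s z, V z ->
  {for z, continuous (iter_derive s f)} /\
  (forall v, derivable (iter_derive s f) z v).

Definition smooth_map_on V (f : R * R -> R * R) :=
  smooth_on V (fst \o f) /\ smooth_on V (snd \o f).

Lemma iter_deriveP V a f g s : open V -> smooth_on V f -> smooth_on V g ->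
  forall z, V z ->
    iter_derive s (a *: f + g) z =
      a * iter_derive s f z + iter_derive s g z.
Proof.
move=> oV sf sg; elim: s => [//|v s IHs] z Vz /=.
have [_ /(_ v) df] := sf s z Vz; have [_ /(_ v) dg] := sg s z Vz.
rewrite (@near_eq_derive _ _ _ _ (a *: iter_derive s f + iter_derive s g)).
  by rewrite deriveD ?deriveZ//; exact: derivableZ.
by near=> w; apply: IHs; near: w; exact: open_nbhs_nbhs.
Unshelve. all: by end_near. Qed.

Lemma smooth_onP V a f g : open V -> smooth_on V f -> smooth_on V g ->
  smooth_on V (a *: f + g).
Proof.
move=> oV sf sg s z Vz.
have [cf df] := sf s z Vz; have [cg dg] := sg s z Vz.
have E : \forall w \near z, (a *: iter_derive s f + iter_derive s g) w =
    iter_derive s (a *: f + g) w.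
  near=> w; rewrite (iter_deriveP _ _ oV sf sg)//.
  by near: w; exact: open_nbhs_nbhs.
split=> [|v].
  rewrite /prop_for /continuous_at (iter_deriveP _ _ oV sf sg)//.
  apply: cvg_trans; first exact: (near_eq_cvg E).
  by apply: cvgD => //; apply: cvgZr.
apply: (near_eq_derivable E); apply: derivableD => //.
exact: derivableZ.
Unshelve. all: by end_near. Qed.

Lemma smooth_on0 V : smooth_on V (0 : R * R -> R).
Proof.
have E s : iter_derive s (0 : R * R -> R) = cst 0.
  elim: s => [//|v s /= ->]; apply/funext => z; exact: derive_cst.
move=> s z _; rewrite E; split=> [|v]; first exact: cvg_cst.
exact: derivable_cst.
Qed.

Definition compacts_in (X : topologicalType) (A : set X) : set (set X) :=
  [set K | compact K /\ K `<=` A].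

Definition alternating_form k (a : ('I_k -> R * R) -> R) :=
  (forall (v : 'I_k -> R * R) (l : 'I_k) (t : R) (x y : R * R),
     a [eta v with l |-> t *: x + y] =
       t * a [eta v with l |-> x] + a [eta v with l |-> y]) /\
  (forall (v : 'I_k -> R * R) (l m : 'I_k), l != m -> v l = v m -> a v = 0).

End Smooth.

Definition homeomorphism_on (X Y : topologicalType) (A : set X) (B : set Y)
    (f : X -> Y) (g : Y -> X) :=
  [/\ {homo f : x / A x >-> B x}, {homo g : y / B y >-> A y},
      (forall x, A x -> g (f x) = x), (forall y, B y -> f (g y) = y) &
      {within A, continuous f} /\ {within B, continuous g}].

(* Box i is the domain U_i of the chart h_i : U_i -> V_i * C_i (with inverse
   [chart_inv i]).  On chart i, the change of charts h_i h_j^-1 is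
   (z, c) |-> (f_ij z, g_ij c) with f_ij = [left_part i j] and
   g_ij = [hol i j]. *)
Record atlas (R : realType) (M : metricType R) := Atlas {
  box : Type;
  dom : box -> set M;
  plaque : box -> set (R * R);
  transversal : box -> metricType R;
  chart : forall i, M -> (R * R) * transversal i;
  chart_inv : forall i, (R * R) * transversal i -> M;
  left_part : box -> box -> R * R;
  hol : forall i j, transversal j -> transversal i;
  dom_cover : \bigcup_i dom i = [set: M];
  dom_open : forall i, open (dom i);
  plaque_open : forall i, open (plaque i);
  plaque_affP : forall i, plaque i `<=` affP;
  transversal_compact : forall i, compact [set: transversal i];
  transversal_td : forall i, totally_disconnected [set: transversal i];
  chart_homeo : forall i, homeomorphism_on (dom i) (plaque i `*` setT)
    (chart i) (@chart_inv i);
  left_part_affP : forall i j, affP (left_part i j);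
  hol_continuous : forall i j,
    {within [set (chart j p).2 | p in dom i `&` dom j], continuous (@hol i j)};
  transition : forall i j p, dom i p -> dom j p ->
    chart i p = (affM (left_part i j) (chart j p).1, @hol i j (chart j p).2)
}.
Arguments chart {R M} a i.
Arguments hol {R M} a i j.
Arguments chart_inv {R M} a i.

Section Leaves.
Context {R : realType} {M : metricType R} (A : atlas M).

Definition slice (i : box A) (c : transversal i) : set M :=
  [set p | dom i p /\ (chart A i p).2 = c].

Inductive leaf (p : M) : set M :=
| leaf_refl : leaf p p
| leaf_step (i : box A) (c : transversal i) (q r : M) :
    leaf p q -> slice c q -> slice c r -> leaf p r.

(* The leaf of p is a smooth surface whose charts are the restrictions of the
   z-component of h_i to the slices it contains; it is diffeomorphic to the
   upper half-plane. *)
Definition leaf_diffeo_H2 (p : M) :=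
  exists (phi : R * R -> M) (psi : M -> R * R),
  [/\ {homo phi : z / affP z >-> leaf p z}, {homo psi : q / leaf p q >-> affP q},
      (forall z, affP z -> psi (phi z) = z),
      (forall q, leaf p q -> phi (psi q) = q) &
      forall (i : box A) (c : transversal i), slice c `<=` leaf p ->
        let W := affP `&` phi @^-1` slice c in
        [/\ open W, smooth_map_on W (fun w => (chart A i (phi w)).1) &
            smooth_map_on (plaque i) (fun z => psi (chart_inv A i (z, c)))]].

End Leaves.

Record solenoid (R : realType) (M : metricType R) := Solenoid {
  satlas :> atlas M;
  sol_compact : compact [set: M];
  sol_nonempty : [set: M] !=set0;
  leaf_H2 : forall p, leaf_diffeo_H2 satlas p;
  sol_act : M -> R * R -> M;
  sol_act_continuous : {within [set pg : M * (R * R) | affP pg.2],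
    continuous (fun pg : M * (R * R) => sol_act pg.1 pg.2)};
  sol_act1 : forall p, sol_act p aff1 = p;
  sol_actM : forall p g h, affP g -> affP h ->
    sol_act (sol_act p g) h = sol_act p (affM g h);
  sol_act_free : forall p g, affP g -> sol_act p g = p -> g = aff1;
  sol_act_orbit : forall p, sol_act p @` affP = leaf satlas p;
  sol_act_chart : forall (i : box satlas) z (c : transversal i) g,
    plaque i z -> affP g -> plaque i (affM z g) ->
    sol_act (chart_inv satlas i (z, c)) g = chart_inv satlas i (affM z g, c)
}.

Section Forms.
Context {R : realType} {M : metricType R} (S : solenoid M) (k : nat).

(* A family of fields of k-linear forms on R * R, one for each slice
   V_i * {c}; the slices are indexed by the pairs (i, c). *)
Definition form_family : Type :=
  {i : box S & transversal i} -> R * R -> ('I_k -> R * R) -> R.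

HB.instance Definition _ := GRing.Lmodule.on form_family.

Definition coef (w : form_family) (i : box S) (v : 'I_k -> R * R)
    (c : transversal i) (z : R * R) : R :=
  w (Tagged (@transversal R M S) c) z v.

Definition form_axiom (w : form_family) :=
  [/\ (forall (i : box S) (c : transversal i) z, plaque i z ->
         alternating_form (fun v => coef w v c z)),
      (forall (i : box S) (c : transversal i) v,
         smooth_on (plaque i) (coef w v c)),
      (* continuity in c for the C^infty topology *)
      (forall (i : box S) (c : transversal i) v s,
         {family compacts_in (plaque i),
           (fun c' => iter_derive s (coef w v c')) @ c -->
           iter_derive s (coef w v c)}),
      (* the form on box j is the pull-back of the form on box i *)
      (forall (i j : box S) p v, dom i p -> dom j p ->
         coef w v (chart S j p).2 (chart S j p).1 =
         coef w (fun l => 'd (affM (left_part i j)) ((chart S j p).1) (v l))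
           (chart S i p).2 (chart S i p).1) &
      (* a form on V_i is represented by its extension by 0 *)
      (forall (i : box S) (c : transversal i) z v, ~ plaque i z ->
         coef w v c z = 0)].

Definition form_pred : {pred form_family} := fun w => `[< form_axiom w >].

Record diff_form := DiffForm { form_val :> form_family ; _ : form_val \in form_pred }.


Lemma family_cvg_linear (X : topologicalType) (V : set (R * R))
    (F : X -> R * R -> R) (G : X -> R * R -> R) (H : X -> R * R -> R) c a :
  (forall c z, V z -> H c z = a * F c z + G c z) ->
  {family compacts_in V, F @ c --> F c} ->
  {family compacts_in V, G @ c --> G c} ->
  {family compacts_in V, H @ c --> H c}.
Proof.
move=> HE /fam_cvgP cF /fam_cvgP cG; apply/fam_cvgP => K KV.
move=> P /uniform_nbhs[E [entE EP]].
have [e e0 eE] : exists2 e : R, 0 < e &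
    [set xy : R * R | ball xy.1 e xy.2] `<=` E.
  by move: entE; rewrite -entourage_ballE => -[e e0 eE]; exists e.
pose d := e / (`|a| + 1) / 2.
have a1 : 0 < `|a| + 1 :> R by rewrite ltr_wpDl.
have d0 : 0 < d by rewrite !divr_gt0.
have de : `|a| * d + d = e / 2.
  by rewrite /d; field; rewrite gt_eqF.
have N (f : R * R -> R) : nbhs (f : {uniform` K -> R})
    [set h : R * R -> R | forall y, K y -> ball (f y) d (h y)].
  apply/uniform_nbhs; exists [set xy : R * R | ball xy.1 d xy.2].
  by split => //; rewrite -entourage_ballE; exists d.
have nF := cF K KV _ (N (F c)); have nG := cG K KV _ (N (G c)).
apply: (@filterS2 _ (nbhs c) _ _ _ _ _ nF nG) => x /= Fx Gx; apply: EP => y Ky; apply: eE => /=.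
have Vy := KV.2 y Ky; rewrite /ball/= !HE//.
have := Fx y Ky; have := Gx y Ky; rewrite /ball/= => gx fx.
rewrite (_ : _ - _ = a * (F c y - F x y) + (G c y - G x y)); last by ring.
rewrite (le_lt_trans (ler_normD _ _))// normrM.
rewrite (@le_lt_trans _ _ (`|a| * d + d))//.
  by rewrite lerD// ?ler_wpM2l// ltW.
by rewrite de ltr_pdivrMr// ltr_pMr// ltr1n.
Qed.

HB.instance Definition _ := [isSub for form_val].
HB.instance Definition _ := [Choice of diff_form by <:].

Lemma form_submod_closed : submod_closed form_pred.
Proof.
have coefE a w1 w2 i v c z :
  @coef (a *: w1 + w2) i v c z = a * coef w1 v c z + coef w2 v c z by [].
split.
  apply/asboolP; split=> //.
  - move=> i c z _; split=> // v l t x y; rewrite /coef/= mulr0 addr0//.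
  - move=> i c v; exact: smooth_on0.
  - move=> i c v s.
    exact: (@cvg_cst _ (iter_derive s 0 : {family compacts_in (plaque i),
      R * R -> R}) _ (nbhs c)).
move=> a w1 w2 /asboolP[l1 s1 c1 t1 z1] /asboolP[l2 s2 c2 t2 z2].
apply/asboolP; split.
- move=> i c z Vz; have [m1 a1] := l1 i c z Vz; have [m2 a2] := l2 i c z Vz.
  split=> [v l t x y|v l m lm vlm]; rewrite !coefE.
    by rewrite m1 m2; ring.
  by rewrite (a1 _ l m)// (a2 _ l m)// mulr0 addr0.
- move=> i c v; apply: (smooth_onP a _ (s1 i c v) (s2 i c v)).
  exact: plaque_open.
- move=> i c v s.
  apply: (family_cvg_linear (a := a) _ (c1 i c v s) (c2 i c v s)) => c' z Vz.
  apply: (iter_deriveP a s _ (s1 i c' v) (s2 i c' v)) => //.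
  exact: plaque_open.
- by move=> i j p v ip jp; rewrite !coefE (t1 i j)// (t2 i j).
- by move=> i c z v Vz; rewrite coefE z1// z2// mulr0 addr0.
Qed.

HB.instance Definition _ := GRing.isSubmodClosed.Build _ _ form_pred
  form_submod_closed.

HB.instance Definition _ := [SubChoice_isSubLmodule of diff_form by <:].

(* Topology of uniform convergence of all the iterated derivatives on the
   compact subsets of the boxes. *)
Definition jets (w : diff_form) :
    prod_topology (fun x : box S * seq (R * R) * ('I_k -> R * R) =>
      {family compacts_in (plaque x.1.1 `*` setT),
        (R * R) * transversal x.1.1 -> R}) :=
  fun x zc => iter_derive x.1.2 (coef w x.2 zc.2) zc.1.

HB.instance Definition _ := Topological.copy diff_form (initial_topology jets).

End Forms.

Section FoliatedCycles.
Context {R : realType} {M : metricType R} (S : solenoid M).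

Definition ext_derive k (w : form_family S k) : form_family S k.+1 :=
  fun s z v => if z \in plaque (tag s) then
    \sum_(l < k.+1) (-1) ^+ l * 'D_(v l) (fun y => w s y (v \o lift l)) z
  else 0.

Definition exact_form k (w : diff_form S k.+1) :=
  exists eta : diff_form S k, form_val w = ext_derive eta.

(* Nonnegative on the bases of R * R of positive orientation. *)
Definition positive_form (w : diff_form S 2) :=
  forall (i : box S) (c : transversal i) z (v : 'I_2 -> R * R), plaque i z ->
    0 < (v ord0).1 * (v ord_max).2 - (v ord0).2 * (v ord_max).1 ->
    0 <= coef w v c z.

Definition foliated_cycle (T : {scalar diff_form S 2}) :=
  [/\ continuous (T : diff_form S 2 -> R),
      (forall w, positive_form w -> 0 <= T w),
      (forall w, exact_form w -> T w = 0) &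
      exists w, T w != 0].

End FoliatedCycles.

(* Main.v *)
(** On the affine group the left-invariant area form [dx dy / y^2] is the
    differential of the left-invariant 1-form [dx / y].  Transition maps being
    left translations, both descend to the solenoid, so a foliated cycle [T]
    kills the invariant area form.  Any other 2-form [w] is [f] times the area
    form with [f] bounded by some [B], by compactness; positivity of
    [B dx dy / y^2 - w] gives [T w <= 0], and replacing [w] by [- w] gives
    [T = 0]. *)
Require Import Defs.
From HB Require Import structures.
From mathcomp Require Import all_boot all_order all_algebra.
From mathcomp Require Import all_classical all_reals all_analysis.
From mathcomp Require Import ring lra.

Set Implicit Arguments.
Unset Strict Implicit.
Unset Printing Implicit Defensive.

Import Order.TTheory GRing.Theory Num.Theory.
Import numFieldNormedType.Exports.

Local Open Scope classical_set_scope.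
Local Open Scope ring_scope.

(** * Calculus on the half-plane: powers of the height and left translations *)

Section HalfPlane.
Context {R : realType}.
Implicit Types (V : set (R * R)) (f : R * R -> R) (v z : R * R).

Lemma is_derive_snd z v : is_derive z v (snd : R * R -> R) v.2.
Proof.
have cv : (fun h : R => h^-1 *: (((snd : R * R -> R) \o shift z) (h *: v) -
    (snd : R * R -> R) z)) @ 0^' --> v.2.
  apply: cvg_near_cst; near=> h; rewrite /= addrK scalerA mulVf ?scale1r//.
  by near: h; exact: nbhs_dnbhs_neq.
by apply: DeriveDef; [apply/cvg_ex; exists v.2|exact/cvg_lim].
Unshelve. all: by end_near. Qed.

Lemma is_derive_snd_invX (a : R) n z v : z.2 != 0 ->
  is_derive z v (fun w : R * R => a / w.2 ^+ n)
    (- (a * n%:R * v.2) / z.2 ^+ n.+1).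
Proof.
move=> z0; have dX := is_deriveX n (is_derive_snd z v).
have zn0 : ((snd : R * R -> R) ^+ n) z != 0 by rewrite exprfctE expf_neq0.
have dV : is_derive z v (fun w : R * R => (((snd : R * R -> R) ^+ n) w)^-1)
    (- (z.2 ^+ n) ^- 2 *: ((n%:R * z.2 ^+ n.-1) *: v.2)).
  apply: DeriveDef; first by apply: derivableV => //; exact: ex_derive.
  by rewrite deriveV// derive_val exprfctE.
rewrite (_ : (fun w => _) = a *: (fun w => (((snd : R * R -> R) ^+ n) w)^-1)).
  apply: (is_derive_eq (is_deriveZ a dV)).
  (* At [n = 0] the exponent [n.-1] is truncated to 0, but its factor [n%:R] vanishes; hence the
     separate case. *)
  rewrite /GRing.scale/=; case: n {dX zn0 dV} => [|n] /=; first by field.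
  by rewrite !exprS; field; rewrite expf_neq0.
by apply/funext => w; rewrite fctE.
Qed.

(** The functions [b / y ^ m] are stable under directional derivatives. As [V] is open, agreement on
    [V] suffices, which allows for forms extended by 0. *)
Lemma iter_derive_snd_invX V f (a : R) n s : open V -> V `<=` affP ->
  (forall z, V z -> f z = a / z.2 ^+ n) ->
  exists b m, forall z, V z -> iter_derive s f z = b / z.2 ^+ m.
Proof.
move=> oV VP fE; elim: s => [|v s [b [m IHs]]]; first by exists a, n.
exists (- (b * m%:R * v.2)), m.+1 => z Vz /=.
rewrite (@near_eq_derive _ _ _ _ (fun w : R * R => b / w.2 ^+ m)).
  by apply/derive_val/is_derive_snd_invX; rewrite gt_eqF//; exact: VP.
by near=> w; apply: IHs; near: w; exact: open_nbhs_nbhs.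
Unshelve. all: by end_near. Qed.

Lemma smooth_on_snd_invX V f (a : R) n : open V -> V `<=` affP ->
  (forall z, V z -> f z = a / z.2 ^+ n) -> smooth_on V f.
Proof.
move=> oV VP fE s z Vz.
have [b [m E]] := iter_derive_snd_invX s oV VP fE.
have z0 : z.2 != 0 by rewrite gt_eqF//; exact: VP.
have nE : \forall w \near z, b / w.2 ^+ m = iter_derive s f w.
  by near=> w; rewrite E//; near: w; exact: open_nbhs_nbhs.
split=> [|v].
  rewrite /prop_for /continuous_at E//.
  apply: cvg_trans; first exact: (near_eq_cvg nE).
  apply: cvgM; first exact: cvg_cst.
  apply: cvgV; first by rewrite expf_neq0.
  apply: (@continuous_comp _ _ _ (snd : R * R -> R) (fun y => y ^+ m)).
    exact: cvg_snd.
  exact: exprn_continuous.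
apply: (near_eq_derivable nE).
exact/ex_derive/is_derive_snd_invX.
Unshelve. all: by end_near. Qed.

(** [affM g] is the homothety of ratio [g.2] followed by a horizontal translation, so its
    differential is a scalar. *)
Lemma diff_affM (g z : R * R) : 'd (affM g) z = *:%R g.2 :> (R * R -> R * R).
Proof.
rewrite (_ : affM g = cst (g.1, 0) + g.2 *: id).
  have dg := is_diffD (is_diff_cst (g.1, 0 : R) z)
    (is_diffZ g.2 (is_diff_id z)).
  rewrite (@diff_val _ _ _ _ _ _ _ dg); apply/funext => v.
  by rewrite /= add0r.
apply/funext => h; rewrite /affM; congr pair; rewrite /= /GRing.scale/=.
  by rewrite mulrC.
by rewrite add0r mulrC.
Qed.

Lemma compact_nbhs_in (V : set (R * R)) (z : R * R) : nbhs z V ->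
  exists K, [/\ compact K, nbhs z K & K `<=` V].
Proof.
case=> -[P Q] /= [/nbhs_closedballP[r rP] /nbhs_closedballP[s sQ]] PQV.
exists (closed_ball z.1 r%:num `*` closed_ball z.2 s%:num); split.
- by apply: compact_setX; exact: closed_ballR_compact.
- exists (closed_ball z.1 r%:num, closed_ball z.2 s%:num) => //.
  by split; apply/nbhs_closedballP; [exists r|exists s].
- by move=> x [x1 x2]; apply: PQV; split; [exact: rP|exact: sQ].
Qed.

End HalfPlane.

(** * Alternating bilinear forms on the plane *)

Section TwoForms.
Context {R : realType}.
Implicit Types (v : 'I_2 -> R * R).

Lemma ord2 (l : 'I_2) : l = ord0 \/ l = ord_max.
Proof. by case: l => -[|[|//]] l2; [left|right]; exact: val_inj. Qed.

Definition det2 v : R := (v ord0).1 * (v ord_max).2 - (v ord0).2 * (v ord_max).1.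

Definition frame : 'I_2 -> R * R := fun l => if l == ord0 then (1, 0) else (0, 1).

Lemma alternating_form2E (a : ('I_2 -> R * R) -> R) v :
  alternating_form a -> a v = det2 v * a frame.
Proof.
move=> [alin aalt].
pose b x y := a (fun l : 'I_2 => if l == ord0 then x else y).
have bE w : a w = b (w ord0) (w ord_max).
  by congr a; apply/funext => l; case: (ord2 l) => ->.
have bl t x y w : b (t *: x + y) w = t * b x w + b y w.
  have := alin (fun l => if l == ord0 then x else w) ord0 t x y.
  by rewrite !bE.
have br t x y w : b w (t *: x + y) = t * b w x + b w y.
  have := alin (fun l => if l == ord0 then w else x) ord_max t x y.
  by rewrite !bE.
have bb x : b x x = 0 by rewrite /b (aalt _ ord0 ord_max).
have b0l y : b 0 y = 0.
  by have := bl 1 0 0 y; rewrite scaler0 addr0 mul1r; lra.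
have b0r y : b y 0 = 0.
  by have := br 1 0 0 y; rewrite scaler0 addr0 mul1r; lra.
pose e1 : R * R := (1, 0); pose e2 : R * R := (0, 1).
(* The trailing 0 makes both sums match the pattern [t *: x + y] of [bl] and [br]. *)
have xE (x : R * R) : x = x.1 *: e1 + (x.2 *: e2 + 0).
  case: x => x1 x2; rewrite addr0; congr pair => /=.
    by rewrite /GRing.scale/= mulr1 mulr0 addr0.
  by rewrite /GRing.scale/= mulr1 mulr0 add0r.
(* Polarization: expand [b] on the diagonal at [e1 + e2]. *)
have anti : b e2 e1 = - b e1 e2.
  have := bb (1 *: e1 + e2); rewrite bl !br !bb; lra.
have -> : a frame = b e1 e2 by rewrite bE.
rewrite bE [v ord0 in LHS]xE [v ord_max in LHS]xE.
rewrite !(bl, br) !(b0l, b0r, bb) anti /det2; ring.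
Qed.

Lemma alternating_form_det2 : alternating_form det2.
Proof.
split=> [v l t x y|v l m].
  by case: (ord2 l) => ->; rewrite /det2/= /GRing.scale/=; ring.
by case: (ord2 l) => ->; case: (ord2 m) => -> //= _; rewrite /det2 => ->; ring.
Qed.

End TwoForms.

(** * Left-invariant forms on the solenoid *)

Section InvariantForms.
Context {R : realType} {M : metricType R} (S : solenoid M).

(* For an alternating form [lam] of degree [k], the left-invariant form which
   is [lam] at the unit of the affine group. *)
Definition invariant_family k (lam : ('I_k -> R * R) -> R) : form_family S k :=
  fun s z v => if z \in plaque (tag s) then lam v / z.2 ^+ k else 0.

Lemma invariant_familyE k (lam : ('I_k -> R * R) -> R) (i : box S)
    (c : Defs.transversal i) v z :
  plaque i z -> coef (invariant_family lam) v c z = lam v / z.2 ^+ k.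
Proof. by move=> iz; rewrite /coef /invariant_family mem_set. Qed.

Lemma chart_plaque (i : box S) p : dom i p -> plaque i (chart S i p).1.
Proof. by move=> ip; have [h _ _ _ _] := chart_homeo i; case: (h p ip). Qed.

(** A change of charts is a homothety up to translation: by homogeneity it multiplies [lam] by the
    [k]-th power of its ratio, and [y ^ k] by the same factor, so the quotient is preserved. The
    coefficients do not involve [c], whence transverse continuity. *)
Lemma invariant_form_axiom k (lam : ('I_k -> R * R) -> R) :
  alternating_form lam ->
  (forall t v, lam (fun l => t *: v l) = t ^+ k * lam v) ->
  form_axiom (invariant_family lam).
Proof.
move=> [lin alt] homog; split.
- move=> i c z iz; split=> [v l t x y|v l m lm vlm];
    rewrite !invariant_familyE//.
    by rewrite lin; ring.
  by rewrite (alt _ l m)// mul0r.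
- move=> i c v; apply: (@smooth_on_snd_invX _ _ _ (lam v) k).
  + exact: plaque_open.
  + exact: plaque_affP.
  + by move=> z iz; rewrite invariant_familyE.
- move=> i c v s.
  exact: (@cvg_cst _ (iter_derive s (coef (invariant_family lam) v c) :
    {family compacts_in (plaque i), R * R -> R}) _ (nbhs c)).
- move=> i j p v ip jp; rewrite !invariant_familyE; try exact: chart_plaque.
  have g0 : (left_part i j).2 != 0.
    by rewrite gt_eqF//; exact: (left_part_affP i j).
  have z0 : (chart S j p).1.2 != 0.
    by rewrite gt_eqF//; exact/(@plaque_affP _ _ _ j)/chart_plaque.
  rewrite diff_affM homog (transition ip jp) /= exprMn.
  by field; rewrite !expf_neq0.
- by move=> i c z v iz; rewrite /coef /invariant_family memNset.
Qed.

Lemma alternating_form_fst :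
  alternating_form (fun v : 'I_1 -> R * R => (v ord0).1).
Proof.
by split=> [v l t x y|v l m]; rewrite (ord1 l) ?(ord1 m).
Qed.

Lemma mem_form_pred k (w : form_family S k) :
  form_axiom w -> w \in form_pred (k := k).
Proof. by move=> ?; apply/asboolP. Qed.

Definition dx_over_y : diff_form S 1 :=
  DiffForm (mem_form_pred (invariant_form_axiom alternating_form_fst
    (fun t v => erefl))).

Lemma det2_homog t (v : 'I_2 -> R * R) :
  det2 (fun l => t *: v l) = t ^+ 2 * det2 v.
Proof. by rewrite /det2/= /GRing.scale/=; ring. Qed.

Definition area_form : diff_form S 2 :=
  DiffForm (mem_form_pred (invariant_form_axiom alternating_form_det2
    det2_homog)).

Lemma area_form_exact : exact_form area_form.
Proof.
exists dx_over_y; apply/funext => -[i c]; apply/funext => z; apply/funext => v.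
rewrite /= /ext_derive /invariant_family/=; case: ifPn => // /set_mem iz.
(* The extension by 0 is invisible near [z], the plaque being open. *)
have D (u x : R * R) : 'D_u (fun y : R * R =>
    if y \in plaque i then x.1 / y.2 ^+ 1 else 0) z = - (x.1 * u.2) / z.2 ^+ 2.
  rewrite (@near_eq_derive _ _ _ _ (fun y : R * R => x.1 / y.2 ^+ 1)).
    have z0 : z.2 != 0 by rewrite gt_eqF//; exact: plaque_affP iz.
    by have /@derive_val -> := is_derive_snd_invX x.1 1 u z0; rewrite mulr1.
  near=> y; rewrite mem_set//; near: y.
  by apply: open_nbhs_nbhs; split=> //; exact: plaque_open.
(* The two summands give [- dy dx / y ^ 2], that is [det2 v / y ^ 2]. *)
rewrite !big_ord_recl big_ord0 /= !D /det2.
have -> : lift ord0 ord0 = ord_max :> 'I_2 by exact/val_inj.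
have -> : lift ord_max ord0 = ord0 :> 'I_2 by exact/val_inj.
by rewrite /= addr0 !expr0 ?expr1; ring.
Unshelve. all: by end_near. Qed.

End InvariantForms.

(** * Boundedness of 2-forms relative to the area form *)

Section Density.
Context {R : realType} {M : metricType R} (S : solenoid M).

Lemma diff_formP k (w : diff_form S k) : form_axiom w.
Proof. by case: w => w wP; exact/asboolP. Qed.

(** Slices converge uniformly on a compact neighbourhood of [z0], which turns continuity in [z]
    along the slice of [c0] into a bound in both variables. *)
Lemma coef_near_bounded k (w : diff_form S k) (i : box S) v z0
    (c0 : Defs.transversal i) : plaque i z0 ->
  exists B, \forall zc \near (z0, c0), `|coef w v zc.2 zc.1| <= B.
Proof.
move=> iz0; have [_ sw cw _ _] := diff_formP w.
have [K [cK nK Ki]] : exists K, [/\ compact K, nbhs z0 K & K `<=` plaque i].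
  by apply: compact_nbhs_in; apply: open_nbhs_nbhs; split=> //; exact: plaque_open.
have cz : coef w v c0 @ z0 --> coef w v c0 z0 by have [] := sw i c0 v [::] z0 iz0.
have nz : \forall z \near z0, `|coef w v c0 z - coef w v c0 z0| < 1.
  by move/cvgr_distC_lt: cz; apply; rewrite ltr01.
have /fam_cvgP/(_ K (conj cK Ki)) uw := cw i c0 v [::].
have nc : \forall c \near c0, forall z, K z ->
    `|coef w v c0 z - coef w v c z| < 1.
  apply: (uw [set h : R * R -> R | forall z, K z -> `|coef w v c0 z - h z| < 1]).
  apply/uniform_nbhs; exists [set xy : R * R | ball xy.1 1 xy.2].
  by split => //; rewrite -entourage_ballE; exists 1 => /=.
(* One unit pays for moving [z] along the slice of [c0], the other for moving from [c0] to [c]. *)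
exists (`|coef w v c0 z0| + 1 + 1).
exists (K `&` [set z | `|coef w v c0 z - coef w v c0 z0| < 1],
  [set c | forall z, K z -> `|coef w v c0 z - coef w v c z| < 1]) => /=.
  by split=> //; exact: filterI.
move=> [z c] /= [[Kz z1] /(_ z Kz) c1].
rewrite (_ : coef w v c z = coef w v c0 z0 + (coef w v c0 z - coef w v c0 z0)
  - (coef w v c0 z - coef w v c z)); last by ring.
rewrite (le_trans (ler_normB _ _))// lerD ?(ltW c1)//.
by rewrite (le_trans (ler_normD _ _))// lerD// ltW.
Qed.

(* The quotient of [w] by the invariant area form, read in chart [i]. *)
Definition density (w : diff_form S 2) (i : box S) (p : M) : R :=
  coef w frame (chart S i p).2 (chart S i p).1 * (chart S i p).1.2 ^+ 2.

(** The pull-back multiplies the value on [frame] by the determinant of a homothety, the square of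
    its ratio; the squared heights in the two charts differ by the same factor. *)
Lemma density_chart_indep w i j p : dom i p -> dom j p ->
  density w i p = density w j p.
Proof.
move=> ip jp; have [aw _ _ tw _] := diff_formP w.
have y_i : (chart S i p).1.2 = (chart S j p).1.2 * (left_part i j).2.
  by rewrite (transition ip jp).
rewrite /density y_i (tw i j p _ ip jp) diff_affM.
rewrite [in RHS](alternating_form2E _ (aw i (chart S i p).2 _ (chart_plaque ip))).
rewrite (_ : det2 _ = (left_part i j).2 ^+ 2); first by rewrite exprMn; ring.
by rewrite /det2 /frame/= /GRing.scale/=; ring.
Qed.

Lemma density_near_bounded w i p : dom i p ->
  exists B, \forall q \near p, dom i q /\ `|density w i q| <= B.
Proof.
move=> ip; have iz := chart_plaque ip.
have [B nB] := coef_near_bounded w frame (chart S i p).2 iz.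
have n2 : \forall zc \near ((chart S i p).1, (chart S i p).2),
    `|zc.1.2| <= `|(chart S i p).1.2| + 1.
  have /cvgr_norm_le : (fun zc : (R * R) * Defs.transversal i => zc.1.2) @
      ((chart S i p).1, (chart S i p).2) --> (chart S i p).1.2.
    apply: (@continuous_comp _ _ _ (fst : (R * R) * Defs.transversal i -> R * R) snd).
      exact: cvg_fst.
    exact: cvg_snd.
  by apply; rewrite ltrDl.
have [_ _ _ _ [+ _]] := chart_homeo i (a := S).
rewrite continuous_open_subspace; last exact: dom_open.
move=> /(_ p (mem_set ip)) cont.
exists (B * (`|(chart S i p).1.2| + 1) ^+ 2).
have nq : \forall q \near p, `|coef w frame (chart S i q).2 (chart S i q).1| <= B /\
    `|(chart S i q).1.2| <= `|(chart S i p).1.2| + 1.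
  apply: (cont [set zc | `|coef w frame zc.2 zc.1| <= B /\
    `|zc.1.2| <= `|(chart S i p).1.2| + 1]).
  rewrite (surjective_pairing (chart S i p)).
  exact: filterI nB n2.
near=> q; have [qB q2] : `|coef w frame (chart S i q).2 (chart S i q).1| <= B /\
    `|(chart S i q).1.2| <= `|(chart S i p).1.2| + 1 by near: q.
split; first by near: q; apply: open_nbhs_nbhs; split=> //; exact: dom_open.
by rewrite normrM normrX ler_pM// lerXn2r ?nnegrE.
Unshelve. all: by end_near. Qed.

Lemma density_bounded w :
  exists B, forall i p, dom i p -> `|density w i p| <= B.
Proof.
(* The bound [B] is the parameter, tending to infinity: bounds valid locally for all large [B] merge
   into a global one. *)
have /compact_near_coveringP/(_ R (+oo%R : set_system R)
  (fun B p => forall i, dom i p -> `|density w i p| <= B)) := sol_compact S.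
have FF : Filter (+oo%R : set_system R) by exact: _.
move=> /(_ FF) near_bound.
have : \forall B \near +oo%R,
    [set: M] `<=` [set p | forall i, dom i p -> `|density w i p| <= B].
  apply: near_bound => p _.
  have [i _ ip] : (\bigcup_i @dom _ _ S i) p by rewrite dom_cover.
  have [B nB] := density_near_bounded w ip.
  exists ([set q | dom i q /\ `|density w i q| <= B], [set C | B <= C]) => /=.
    by split=> //; apply: nbhs_pinfty_ge; exact: num_real.
  (* The local bound was found in chart [i]; chart independence carries it to any chart [j] around
     [q]. *)
  move=> [q C] /= [[iq qB] BC] j jq.
  by rewrite (density_chart_indep w jq iq) (le_trans qB).
move=> /filter_ex[B hB]; exists B => i p; exact: hB.
Qed.

End Density.

Theorem proposition3p1 (R : realType) (M : metricType R) (S : solenoid M) :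
  ~ exists T : {scalar diff_form S 2}, foliated_cycle T.
Proof.
move=> [T [_ Tpos Texact [w /eqP]]]; apply.
have Tarea : T (area_form S) = 0 by apply: Texact; exact: area_form_exact.
have T_le0 u : T u <= 0.
  have [B uB] := density_bounded u; have [au _ _ _ _] := diff_formP u.
  suff : 0 <= T (B *: area_form S - u).
    by rewrite linearB linearZ Tarea /= mulr0 sub0r oppr_ge0.
  apply: Tpos => i c z v iz v_pos.
  have [_ hinv _ /(_ (z, c)) ck _] := chart_homeo i (a := S).
  have ip : dom i (chart_inv S i (z, c)) by apply: hinv.
  have := uB i _ ip; rewrite /density ck//= => /ler_normlP[_ fB].
  have z0 : 0 < z.2 by exact: plaque_affP iz.
  have -> : coef (B *: area_form S - u) v c z =
      B * coef (area_form S) v c z - coef u v c z by [].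
  rewrite invariant_familyE// (alternating_form2E _ (au i c z iz)).
  (* The last factor is [B] minus the density of [u]; [det2 v] is positive by orientation. *)
  rewrite (_ : _ - _ = det2 v / z.2 ^+ 2 * (B - coef u frame c z * z.2 ^+ 2)).
    by rewrite mulr_ge0 ?subr_ge0// divr_ge0 ?exprn_ge0// ltW.
  by field; rewrite gt_eqF.
(* [T_le0] is applied to [w] and to [- w]. *)
by apply/eqP; rewrite eq_le T_le0 -oppr_le0 -linearN T_le0.
Qed.
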